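(* For every algebraic language $\Omega$ and every nontrivial variety $\mathbf{V}$ of $\Omega$-algebras, the category $\mathbf{V}^{\mathit{fin}}_{\mathit{epi}}$, whose objects are the finite algebras in $\mathbf{V}$ and whose morphisms are epimorphisms, has finite dual small Ramsey degrees.
   Context: An algebraic language $\Omega$ is a set of constant and functional symbols (each with a finite arity). An $\Omega$-algebra $(A,\Omega^A)$ is a nonempty set $A$ with an operation $f^A$ of the appropriate arity for each $f\in\Omega$. A class $\mathbf{V}$ of $\Omega$-algebras is a variety if it is the class of all $\Omega$-algebras satisfying some set of identities $t_1\approx t_2$ between $\Omega$-terms; it is nontrivial if it contains an algebra with at least two elements. ''Epimorphism'' of algebras means surjective homomorphism. Let $\mathbf{C}$ be a locally small category. For integers $k\ge2$, $t\ge1$ and objects $A,B,C$, write $C\longleftarrow(B)^A_{k,t}$ if for every coloring $\chi:\hom_{\mathbf{C}}(C,A)\to\{0,\dots,k-1\}$ there is a morphism $w\in\hom_{\mathbf{C}}(C,B)$ with $|\chi(\hom_{\mathbf{C}}(B,A)\cdot w)|\le t$, where $\hom_{\mathbf{C}}(B,A)\cdot w=\{f\cdot w:f\in\hom_{\mathbf{C}}(B,A)\}$. The dual small Ramsey degree $t^\partial_{\mathbf{C}}(A)$ is the least positive integer $n$ such that for all $k\ge2$ and all objects $B$ there is an object $C$ with $C\longleftarrow(B)^A_{k,n}$, if such an integer exists, and $\infty$ otherwise. $\mathbf{C}$ has finite dual small Ramsey degrees if $t^\partial_{\mathbf{C}}(A)<\infty$ for every object $A$ of $\mathbf{C}$.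 *)

(* Defs.v *)
From mathcomp Require Import all_boot.
From mathcomp Require Import boolp classical_sets cardinality.

Set Implicit Arguments.
Unset Strict Implicit.
Unset Printing Implicit Defensive.

Local Open Scope classical_set_scope.

(* Small hom-types; [comp f w] is the composite written f . w, that is, f
   after w. *)
Record category := Category {
  obj :> Type;
  hom : obj -> obj -> Type;
  idm : forall A, hom A A;
  comp : forall A B C, hom B C -> hom A B -> hom A C;
  comp_idl : forall A B (f : hom A B), comp (idm B) f = f;
  comp_idr : forall A B (f : hom A B), comp f (idm A) = f;
  comp_assoc : forall A B C D (f : hom C D) (g : hom B C) (h : hom A B),
    comp f (comp g h) = comp (comp f g) h
}.

Section DualRamsey.
Variable C : category.
Implicit Types A B X : C.

(* The colors taken by chi on hom(B, A) . w. *)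
Definition colors k A B X (chi : hom X A -> 'I_k) (w : hom X B) : {set 'I_k} :=
  [set c | `[< exists f : hom B A, chi (comp f w) = c >]]%SET.

(* X <-- (B)^A_{k,t} *)
Definition dual_arrow X B A (k t : nat) : Prop :=
  forall chi : hom X A -> 'I_k,
  exists w : hom X B, #|colors chi w| <= t.

Definition dual_ramsey_bound A (n : nat) : Prop :=
  0 < n /\
  forall k, 2 <= k -> forall B, exists X : C, dual_arrow X B A k n.

(* [None] stands for infinity. *)
Definition dual_small_ramsey_degree A : option nat :=
  match pselect (exists n, `[< dual_ramsey_bound A n >]) with
  | left ex_n => Some (ex_minn ex_n)
  | right _ => None
  end.

Definition finite_dual_small_ramsey_degrees : Prop :=
  forall A, exists n, dual_small_ramsey_degree A = Some n.

End DualRamsey.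

(* Constants are the symbols of arity 0. *)
Record language := Language {
  symbol :> Type;
  arity : symbol -> nat
}.

Section UniversalAlgebra.
Variable Omega : language.

Record algebra := Algebra {
  carrier :> Type;
  carrier_nonempty : inhabited carrier;
  op : forall f : Omega, {ffun 'I_(arity f) -> carrier} -> carrier
}.

(* Terms over the countably infinite set of variables nat. *)
Inductive term : Type :=
| Var of nat
| App (f : Omega) of {ffun 'I_(arity f) -> term}.

Fixpoint eval (A : algebra) (v : nat -> A) (t : term) : A :=
  match t with
  | Var n => v n
  | App f ts => op [ffun i => eval v (ts i)]
  end.

Definition satisfies (A : algebra) (e : term * term) : Prop :=
  forall v : nat -> A, eval v e.1 = eval v e.2.

Definition variety (V : set algebra) : Prop :=
  exists E : set (term * term),
    V = [set A | forall e, E e -> satisfies A e].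

Definition nontrivial (V : set algebra) : Prop :=
  exists2 A : algebra, V A & exists x y : A, x <> y.

Definition homomorphism (A B : algebra) (h : A -> B) : Prop :=
  forall (f : Omega) (a : {ffun 'I_(arity f) -> A}),
    h (op a) = op [ffun i => h (a i)].

Record epi (A B : algebra) := Epi {
  epi_fun :> A -> B;
  epi_hom : homomorphism epi_fun;
  epi_surj : forall y : B, exists x : A, epi_fun x = y
}.

Lemma epi_ext A B (g h : epi A B) : epi_fun g = epi_fun h -> g = h.
Proof.
case: g h => [g hg sg] [h hh sh] /= e; move: hg sg; rewrite e => hg sg.
by rewrite (Prop_irrelevance hg hh) (Prop_irrelevance sg sh).
Qed.

Lemma homomorphism_id A : @homomorphism A A id.
Proof. by move=> f a; congr (op _); apply/ffunP => i; rewrite ffunE. Qed.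

Lemma surj_id (A : algebra) (y : A) : exists x : A, id x = y.
Proof. by exists y. Qed.

Definition epi_id A : epi A A := Epi (@homomorphism_id A) (@surj_id A).

Lemma homomorphism_comp A B C (g : epi B C) (h : epi A B) :
  homomorphism (g \o h).
Proof.
move=> f a /=; rewrite epi_hom epi_hom; congr (op _).
by apply/ffunP => i; rewrite !ffunE.
Qed.

Lemma surj_comp A B C (g : epi B C) (h : epi A B) (z : C) :
  exists x : A, (g \o h) x = z.
Proof.
by have [y <-] := epi_surj g z; have [x <-] := epi_surj h y; exists x.
Qed.

Definition epi_comp A B C (g : epi B C) (h : epi A B) : epi A C :=
  Epi (homomorphism_comp g h) (surj_comp g h).

Variable V : set algebra.

Record fin_algebra_in := FinAlgebraIn {
  fin_alg :> algebra;
  fin_alg_in : V fin_alg;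
  fin_alg_finite : finite_set [set: fin_alg]
}.

Lemma epi_comp_idl (A B : fin_algebra_in) (f : epi A B) :
  epi_comp (epi_id B) f = f.
Proof. exact: epi_ext. Qed.

Lemma epi_comp_idr (A B : fin_algebra_in) (f : epi A B) :
  epi_comp f (epi_id A) = f.
Proof. exact: epi_ext. Qed.

Lemma epi_comp_assoc (A B C D : fin_algebra_in)
    (f : epi C D) (g : epi B C) (h : epi A B) :
  epi_comp f (epi_comp g h) = epi_comp (epi_comp f g) h.
Proof. exact: epi_ext. Qed.

Definition fin_epi_category : category :=
  @Category fin_algebra_in (fun A B => epi A B) (fun A => epi_id A)
    (fun A B C => @epi_comp A B C)
    epi_comp_idl epi_comp_idr epi_comp_assoc.

End UniversalAlgebra.

(* Main.v *)
Require Import Defs.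
From mathcomp Require Import all_boot.
From mathcomp Require Import boolp classical_sets cardinality.
From mathcomp Require Import zify.

Set Implicit Arguments.
Unset Strict Implicit.
Unset Printing Implicit Defensive.

(** The statement reduces to the dual Ramsey theorem for finite sets (Graham
and Rothschild): given finite sets A and B and finitely many colors, there is an
N such that every coloring of the maps from an N-element set to A admits a
surjection w of that set onto B for which the composites g . w, with g ranging
over the surjections from B onto A, take a number of colors that is bounded in
terms of A only ([dual_ramsey]).

For the reduction, a finite algebra B of V has a finite algebra of N-ary term
functions ([term_algebra]), which is generated by the N projections.  It lies in
V, being a subalgebra of a power of B.  Evaluation at an N-tuple w that lists
all of B is an epimorphism from it onto B, and a homomorphism out of it is
determined by its values on the projections ([hom_eq_generators]).  So a
coloring of the epimorphisms onto A is a partial coloring of N-tuples of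
elements of A,
and composing an epimorphism f from B to A with evaluation at w amounts to
applying f to the entries of w.  The dual Ramsey theorem for the underlying sets
then supplies w.  Working inside the variety generated by B is what keeps the
algebra finite: V itself may have infinite finitely generated free algebras.

The dual Ramsey theorem comes from its form for rigid words with constant
letters ([graham_rothschild_rigid]).  That form is proved by induction on the
number of parameters, from two reductions.  The first one
([prefix_reduction]) makes the color of a word depend only on the part
that precedes its first parameter; it uses the theorem with one parameter less
and one constant more.  The second one makes the color depend only on the length
of that part, by the multi-dimensional Hales-Jewett theorem for prefixes
([block_lines] with [hales_jewett]).  A pigeonhole argument on the lengths ends
the step.  The Hales-Jewett theorem itself is proved by Shelah's method:
insensitivity to the exchange of two letters removes one letter from the
alphabet. *)

(** * Rigid words and substitution *)

(** Letters below [s] are constants, and the letter [s + i] is the [i]-th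
parameter.  A word [f] is thus read as the map on letters that fixes the
constants and sends the [i]-th parameter to the [i]-th letter of [f]. *)
Definition ext (s : nat) (f : seq nat) c :=
  if c < s then c else nth 0 f (c - s).

Definition sub s f (w : seq nat) := map (ext s f) w.

(** The parameters of a rigid word are [s], ..., [t - 1], all of them occur, and
their first occurrences come in increasing order. *)
Fixpoint rigid (s t : nat) (w : seq nat) :=
  if w is c :: w' then
    if c < s then rigid s t w' else (c == s) && rigid s.+1 t w'
  else s == t.

(** When [size x] is less than the number of parameters of [w], the word [x]
assigns values to an initial segment of the parameters only, and [pre s x w] is
the longest prefix of [w] that these values determine. *)
Definition pre s x (w : seq nat) := sub s x (take (index (s + size x) w) w).

Lemma rigid_cat s t t' v w :
  rigid s t v -> rigid t t' w -> rigid s t' (v ++ w).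
Proof.
elim: v s => [|c v IH] s /=; first by move/eqP ->.
case: ifP => _; first exact: IH.
by case/andP=> -> /= /IH; apply.
Qed.

Lemma rigid_size s t w : rigid s t w -> s <= t <= s + size w.
Proof.
elim: w s => [|c w IH] s /=; first by move/eqP; lia.
by case: ifP => _; [move/IH | case/andP=> _ /IH]; lia.
Qed.

Lemma rigid_lt s t w : rigid s t w -> all (gtn t) w.
Proof.
elim: w s => [|c w IH] s //=.
case: ifP => [cs rw|_ /andP[/eqP -> rw]]; rewrite (IH _ rw) andbT.
  by have := rigid_size rw; lia.
by have := rigid_size rw; lia.
Qed.

Lemma rigid_const_cat s t p w :
  all (gtn s) p -> rigid s t (p ++ w) = rigid s t w.
Proof. by elim: p => [|c p IH] //= /andP[-> /IH]. Qed.

Lemma rigid_const s p : all (gtn s) p -> rigid s s p.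
Proof. by move=> ps; rewrite -[p]cats0 rigid_const_cat //=. Qed.

Lemma rigid_iota s n : rigid s (s + n) (iota s n).
Proof.
elim: n s => [|n IH] s /=; first by rewrite addn0.
by rewrite ltnn eqxx -addSnnS IH.
Qed.

Lemma rigid_bump h s t w :
  h <= s -> rigid s t w -> rigid s.+1 t.+1 (map (bump h) w).
Proof.
elim: w s => [|c w IH] s hs //=.
case: ifP => [cs rw|_ /andP[/eqP -> rw]].
  have -> : bump h c < s.+1 by rewrite /bump; lia.
  exact: IH.
have -> : bump h s = s.+1 by rewrite /bump hs.
by rewrite ltnn eqxx IH // leqW.
Qed.

Lemma rigid_split s t j w : rigid s t w -> s <= j < t ->
  exists w0 w', w = w0 ++ j :: w' /\ all (gtn j) w0.
Proof.
elim: w s => [|c w IH] s /=; first by move/eqP; lia.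
case: ifP => [cs rw sj|_ /andP[/eqP -> rw sj]].
  have [w0 [w' [-> w0j]]] := IH _ rw sj.
  by exists (c :: w0), w'; split=> //=; rewrite w0j andbT; lia.
have [->|nsj] := eqVneq s j; first by exists [::], w.
have [|w0 [w' [-> w0j]]] := IH _ rw; first by lia.
by exists (s :: w0), w'; split=> //=; rewrite w0j andbT; lia.
Qed.

Lemma ext_cons_bump s c f d : ext s (c :: f) (bump s d) = ext s f d.
Proof.
rewrite /ext /bump; case: (leqP s d) => sd /=; rewrite ?add0n ?add1n ?sd //.
by rewrite ifF ?subSn //; lia.
Qed.

Lemma ext_cons_level s f d : ext s (s :: f) d = ext s.+1 f d.
Proof.
rewrite /ext; have [->|nds] := eqVneq d s; first by rewrite ltnn ltnSn subnn.
case: ltnP => ds; first by rewrite leqW.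
have sd : s < d by lia.
by rewrite ltnS leqNgt sd /= -(subnSK sd).
Qed.

Lemma sub_comp s f g w : all (gtn (s + size f)) w ->
  sub s g (sub s f w) = sub s (sub s g f) w.
Proof.
move=> /allP wf; rewrite /sub -map_comp; apply/eq_in_map => c /wf /= cf.
rewrite {2 3}/ext; case: ltnP => cs; first by rewrite /ext cs.
by rewrite (nth_map 0) //; lia.
Qed.

Lemma size_sub s f w : size (sub s f w) = size w.
Proof. exact: size_map. Qed.

Lemma sub_cat s f v w : sub s f (v ++ w) = sub s f v ++ sub s f w.
Proof. exact: map_cat. Qed.

Lemma ext_lt s t f c :
  s <= t -> all (gtn t) f -> c < s + size f -> ext s f c < t.
Proof.
rewrite /ext => st /allP ft cf; case: (ltnP c s) => cs; first by lia.
by have /= := ft (nth 0 f (c - s)); apply; rewrite mem_nth // ltn_subLR.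
Qed.

Lemma sub_lt s t f w : s <= t ->
  all (gtn t) f -> all (gtn (s + size f)) w -> all (gtn t) (sub s f w).
Proof.
move=> st ft /allP wf; apply/allP => _ /mapP[c /wf cf ->].
exact: ext_lt.
Qed.

(** A new parameter of [f] first occurs in the composite where [w] introduces the
position of its first occurrence in [f], and [w] introduces positions in order.
The induction on [w] keeps track of the part [f1] of [f] that corresponds to the
parameters of [w] introduced so far. *)
Lemma rigid_sub s t f w :
  rigid s t f -> rigid s (s + size f) w -> rigid s t (sub s f w).
Proof.
suff gen f1 f2 t1 s' : f = f1 ++ f2 -> s' = s + size f1 ->
    rigid s t1 f1 -> rigid t1 t f2 -> rigid s' (s + size f) w ->
    rigid t1 t (sub s f w).
  by move=> rf; apply: (gen [::] f) => //=; rewrite ?addn0.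
elim: w f1 f2 t1 s' => [|c w IH] f1 f2 t1 s' /= ef es r1 r2.
  move/eqP; rewrite ef size_cat es => e.
  have /size0nil e2 : size f2 = 0 by lia.
  by move: r2; rewrite e2.
case: ifP => [cs rw|_ /andP[/eqP -> rw]].
  suff -> : ext s f c < t1 by apply: (IH f1 f2 t1 s').
  rewrite /ext; case: (ltnP c s) => c's; first by have := rigid_size r1; lia.
  rewrite ef nth_cat ifT; last by lia.
  have /= := allP (rigid_lt r1) (nth 0 f1 (c - s)); apply.
  by rewrite mem_nth // ltn_subLR // -es.
case: f2 ef r2 => [|d f2] ef /= r2.
  by have := rigid_size rw; rewrite ef cats0 es; lia.
have -> : ext s f s' = d.
  rewrite /ext ifF; last by lia.
  by rewrite ef nth_cat ifF ?es; [rewrite addKn subnn|lia].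
have ef' : f = rcons f1 d ++ f2 by rewrite cat_rcons.
have es' : s'.+1 = s + size (rcons f1 d) by rewrite size_rcons; lia.
move: r2; case: ifP => [dt r2|_ /andP[/eqP ed r2]].
  apply: IH ef' es' _ r2 rw; rewrite -cats1.
  by apply: rigid_cat r1 _; rewrite /= dt.
rewrite ed eqxx /=; apply: IH ef' es' _ r2 rw; rewrite -cats1.
by apply: rigid_cat r1 _; rewrite /= ed ltnn !eqxx.
Qed.

Lemma index_new (j : nat) v w :
  all (gtn j) v -> index j (v ++ j :: w) = size v.
Proof.
move=> /allP vj; rewrite index_cat ifF /= ?eqxx ?addn0 //.
by apply/negP => /vj /=; rewrite ltnn.
Qed.

Lemma pre_full s x w : all (gtn (s + size x)) w -> pre s x w = sub s x w.
Proof.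
move=> /allP wx; rewrite /pre memNindex ?take_size //.
by apply/negP => /wx /=; rewrite ltnn.
Qed.

(** If [f] starts with constants [x] and then reaches its first parameter, the
prefix of the composite before its first parameter is determined by [x] alone,
because [w] is rigid. *)
Lemma sub_pre s u x y w (f := x ++ s :: y) :
  all (gtn s) x -> rigid s u f -> rigid s (s + size f) w ->
  exists y', [/\ sub s f w = pre s x w ++ s :: y', all (gtn s) (pre s x w) &
    rigid s.+1 u y'].
Proof.
move=> xs rf rw; have := rigid_sub rf rw.
have [|w0 [w' [ew w0x]]] := rigid_split (j := s + size x) rw.
  by rewrite size_cat /=; lia.
have epre : pre s x w = sub s x w0.
  by rewrite /pre ew index_new // take_size_cat.
have -> : sub s f w = pre s x w ++ s :: sub s f w'.
  rewrite epre ew sub_cat /=; congr (_ ++ _ :: _).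
    apply/eq_in_map => c /(allP w0x) /= cx; rewrite /ext; case: ltnP => // sc.
    by rewrite nth_cat ifT //; lia.
  rewrite /ext ifF; last by lia.
  by rewrite addKn nth_cat ltnn subnn.
have ps : all (gtn s) (pre s x w) by rewrite epre; exact: sub_lt.
by rewrite rigid_const_cat //= ltnn eqxx /=; exists (sub s f w').
Qed.

(** * The Hales-Jewett theorem *)

(** The word [v] has the single parameter [s], so it is a combinatorial line, and
[chi] does not distinguish its point at [c] from its point at [phi c].  With
[phi] constant this is the conclusion of the Hales-Jewett theorem. *)
Definition line_property s (phi : nat -> nat) :=
  forall K : finType, exists n, forall chi : seq nat -> K,
  exists v, [/\ size v = n, rigid s s.+1 v &
    forall c, c < s -> chi (sub s [:: c] v) = chi (sub s [:: phi c] v)].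

(** Shelah's lemma for the two last letters [s] and [s.+1] of the alphabet.  Among
the [#|K| + 1] words [s ... s s.+1 ... s.+1] of length [#|K|], two have the same
color, and they are the points at [s.+1] and [s] of the line that has the
parameter in the positions where they differ. *)
Lemma line_property_merge s : line_property s.+2
  (fun c => if c == s.+1 then s else c).
Proof.
move=> K; exists #|K| => chi.
pose W p := nseq p s ++ nseq (#|K| - p) s.+1.
have [p [q [pq qK eW]]] :
    exists p q, [/\ p < q, q <= #|K| & chi (W p) = chi (W q)].
  have /injectivePn[p [q npq e]] :
      ~~ injectiveb (fun p : 'I_#|K|.+1 => chi (W p)).
    apply/negP => /injectiveP /leq_card.
    by rewrite card_ord ltnn.
  have [lpq|lqp|/val_inj epq] := ltngtP p q; last by rewrite epq eqxx in npq.
    by exists p, q; split=> //; rewrite -ltnS.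
  by exists q, p; split=> //; rewrite -ltnS.
exists (nseq p s ++ nseq (q - p) s.+2 ++ nseq (#|K| - q) s.+1); split.
- by rewrite !size_cat !size_nseq; lia.
- apply: (rigid_cat (t := s.+2)).
    by apply: rigid_const; rewrite all_nseq /= leqW ?orbT.
  apply: (rigid_cat (t := s.+3)).
    case: (q - p) (subn_gt0 p q) => [|n _] /=; first by rewrite pq.
    rewrite ltnn eqxx /=; apply: rigid_const.
    by rewrite all_nseq /= leqnn orbT.
  by apply: rigid_const; rewrite all_nseq /= leqW ?orbT.
move=> c _; case: eqP => // ->.
rewrite !sub_cat /sub !map_nseq /ext !ltnn !subnn /= ltnSn leqW //.
have -> : nseq (q - p) s.+1 ++ nseq (#|K| - q) s.+1 = nseq (#|K| - p) s.+1.
  rewrite -nseqD; congr (nseq _ _); lia.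
rewrite [RHS](_ : _ = chi (W q)) // catA; congr (chi (_ ++ _)).
by rewrite -nseqD; congr (nseq _ _); lia.
Qed.

(** Bounded sequences over ['I_s] form a finite type, which makes it possible to
use the behavior of a coloring on all short words as a color. *)
Lemma bounded_word s (x : seq nat) m : all (gtn s) x -> size x <= m ->
  exists b : m.-bseq 'I_s, x = map val b.
Proof.
move=> /allP xs xm; have sz : size (pmap insub x : seq 'I_s) <= m.
  by apply: leq_trans xm; rewrite size_pmap count_size.
exists (Bseq sz) => /=; rewrite pmap_filter; last exact: insubK.
rewrite (_ : filter _ x = x) //.
by apply/all_filterP/allP => c /xs /= cs; rewrite insubT.
Qed.

Lemma pre_cons s c x v w : rigid s s.+1 v ->
  pre s (c :: x) (v ++ map (bump s) w) = sub s [:: c] v ++ pre s x w.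
Proof.
move=> rv; have vs := allP (rigid_lt rv).
rewrite /pre /= index_cat ifF; last first.
  by apply/negP => /vs /=; lia.
have -> : index (s + (size x).+1) (map (bump s) w) = index (s + size x) w.
  have -> : s + (size x).+1 = bump s (s + size x).
    by rewrite /bump leq_addr; lia.
  by rewrite index_map //; apply: can_inj (@bumpK s).
rewrite take_cat ifF; last by rewrite ltnNge leq_addr.
rewrite addKn sub_cat; congr (_ ++ _).
  apply/eq_in_map => d /vs /=; rewrite /ext; case: (ltnP d s) => // sd ds.
  by have -> : d - s = 0 by lia.
rewrite -map_take /sub -map_comp; apply: eq_map => d /=.
exact: ext_cons_bump.
Qed.

(** Concatenating [m] lines upgrades a line property to [m] parameters, for all
prefixes at once.  The lines after the first one are chosen for the coloring that
records the color behind every possible first block; the first line is then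
chosen for the coloring that records the colors in front of every continuation
of the tail that has just been fixed. *)
Lemma block_lines s phi m (K : finType) : (forall c, c < s -> phi c < s) ->
  line_property s phi ->
  exists N, forall chi : seq nat -> K, exists w,
  [/\ size w = N, rigid s (s + m) w &
    forall x, all (gtn s) x -> size x <= m ->
      chi (pre s x w) = chi (pre s (map phi x) w)].
Proof.
move=> phis hphi; elim: m K => [|m IH] K.
  exists 0 => chi; exists [::]; split=> [||[|]] //=.
  by rewrite addn0.
have [n hn] := hphi {ffun m.-bseq 'I_s -> K}.
have [N hN] := IH {ffun n.-bseq 'I_s -> K}.
exists (n + N) => chi.
have [w [sw rw hw]] :=
  hN (fun z => [ffun p : n.-bseq 'I_s => chi (map val p ++ z)]).
have [v [sv rv hv]] :=
  hn (fun p => [ffun x : m.-bseq 'I_s => chi (p ++ pre s (map val x) w)]).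
exists (v ++ map (bump s) w); split.
- by rewrite size_cat size_map sv sw.
- apply: rigid_cat rv _; rewrite addnS.
  by apply: rigid_bump.
move=> [|c x] //= /andP[cs xs] xm; rewrite !pre_cons //.
have vlt d : d < s -> all (gtn s) (sub s [:: d] v).
  move=> ds; apply: sub_lt => //=; first by rewrite ds.
  by rewrite addn1; exact: rigid_lt rv.
transitivity (chi (sub s [:: phi c] v ++ pre s x w)).
  have [b ->] := bounded_word xs xm.
  by have /ffunP /(_ b) := hv c cs; rewrite !ffunE.
have [||b ->] := @bounded_word s (sub s [:: phi c] v) n.
- exact/vlt/phis.
- by rewrite size_sub sv.
by have /ffunP /(_ b) := hw x xs xm; rewrite !ffunE.
Qed.

(** Induction on the alphabet: in the [m]-dimensional space [w], the last letter
can be replaced by the one before it without changing the color, and a line for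
the smaller alphabet in this space is monochromatic also at its last point. *)
Theorem hales_jewett s : line_property s.+1 (fun=> 0).
Proof.
elim: s => [|s IH] K.
  by exists 1 => chi; exists [:: 1]; split=> // -[].
have [m hm] := IH K.
have [|N hN] := @block_lines s.+2 _ m K _ (@line_property_merge s).
  by move=> c; case: eqP; lia.
exists N => chi; have [w [sw rw hw]] := hN chi.
have [v [sv rv hv]] := hm (fun x => chi (sub s.+2 x w)).
have vlt := allP (rigid_lt rv).
exists (sub s.+2 (map (bump s.+1) v) w); split.
- by rewrite size_sub.
- apply: rigid_sub; first exact: rigid_bump.
  by rewrite size_map sv.
have wlt := rigid_lt rw.
have line c : sub s.+2 [:: c] (sub s.+2 (map (bump s.+1) v) w) =
              sub s.+2 (sub s.+1 [:: c] v) w.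
  rewrite sub_comp ?size_map ?sv //; congr (sub _ _ w).
  rewrite /sub -map_comp; apply/eq_in_map => d /vlt /= ds.
  rewrite /bump /ext; case: (ltnP d s.+1) => sd /=; first by rewrite add0n leqW.
  have -> : d = s.+1 by lia.
  by rewrite add1n ltnn !subnn.
move=> c cs; rewrite !line.
have [->|ncs] := eqVneq c s.+1; last by apply: hv; lia.
have vl : all (gtn s.+2) (sub s.+1 [:: s.+1] v).
  by apply: sub_lt => //=; rewrite ?ltnSn ?addn1 //; exact: rigid_lt rv.
have := hw _ vl; rewrite size_sub sv leqnn => /(_ isT).
rewrite !pre_full ?size_map ?sv // => ->.
rewrite -(hv s) //; congr (chi (sub _ _ w)).
rewrite /sub -map_comp; apply/eq_in_map => d /vlt /= ds.
rewrite /ext; case: (ltnP d s.+1) => sd /=; first by rewrite ifF //; lia.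
have -> : d = s.+1 by lia.
by rewrite subnn /= eqxx.
Qed.

(** * The Graham-Rothschild theorem *)

(** Words with [s] constants and [u - s] parameters are colored, and the large
word [w] has [m] parameters. *)
Definition graham_rothschild (s u : nat) :=
  forall m (K : finType), exists N, forall chi : seq nat -> K,
  exists w, [/\ size w = N, rigid s (s + m) w &
    forall f g, size f = m -> size g = m -> rigid s u f -> rigid s u g ->
      chi (sub s f w) = chi (sub s g w)].

Lemma sub_level s c f w : sub s (c :: f) (s :: w) = c :: sub s (c :: f) w.
Proof. by rewrite /sub /= {1}/ext ltnn subnn. Qed.

(** Turning the constant [s] of a word into the first parameter of a word with one
constant less: substituting [c] for it commutes with the composition. *)
Lemma sub_cons_comp s c f v w : all (gtn (s.+1 + size v)) w ->
  sub s (c :: f) (sub s.+1 (map (bump s) v) w) = sub s (c :: sub s f v) w.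
Proof.
move=> /allP wv; rewrite /sub -map_comp; apply/eq_in_map => d /wv /= dv.
have [ds|sd|->] := ltngtP d s; last first.
- by rewrite {2}/ext ltnSn /ext ltnn subnn.
- have dsv : d - s.+1 < size v by rewrite ltn_subLR.
  rewrite {2}/ext ltnS leqNgt sd /= (nth_map 0) // ext_cons_bump.
  by rewrite [RHS]/ext ltnNge ltnW //= -(subnSK sd) /= (nth_map 0).
- by rewrite {2}/ext leqW // /ext ds.
Qed.

(** The color can be made to depend only on the prefix [x] before the first
parameter.  The word [w] begins with its first parameter, followed by a tail [w2]
with [s.+1] constants, the constant [s] of the tail standing for the first letter.
If the first letter of [f] is its first parameter, the rest of [f] is handled by
the Graham-Rothschild property for [s.+1] constants, which gives [w2].  If it is a
constant [c], the rest of [f] still has all its parameters, and the induction on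
[M] applies inside [w2] to the coloring that records the colors for all [c]. *)
Lemma prefix_reduction s u M (K : finType) : graham_rothschild s.+1 u ->
  exists N, forall chi : seq nat -> K, exists w,
  [/\ size w = N, rigid s (s + M) w &
    forall x y y', all (gtn s) x -> size x + (size y).+1 = M ->
      size y' = size y -> rigid s.+1 u y -> rigid s.+1 u y' ->
      chi (sub s (x ++ s :: y) w) = chi (sub s (x ++ s :: y') w)].
Proof.
move=> gr; elim: M K => [|M IH] K.
  exists 0 => chi; exists [::]; split=> //=.
  by rewrite addn0.
have [N1 hN1] := IH {ffun 'I_s -> K}.
have [N2 hN2] := gr N1 K.
exists N2.+1 => chi.
have [w2 [sw2 rw2 hw2]] := hN2 (fun z => chi (s :: z)).
have [w1 [sw1 rw1 hw1]] :=
  hN1 (fun z => [ffun c : 'I_s => chi (val c :: sub s (val c :: z) w2)]).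
have rw1' : rigid s.+1 (s.+1 + M) (map (bump s) w1) by exact: rigid_bump.
exists (s :: sub s.+1 (map (bump s) w1) w2); split.
- by rewrite /= size_sub sw2.
- rewrite /= ltnn eqxx -addSnnS; apply: rigid_sub => //.
  by rewrite size_map sw1.
move=> [|c x] y y'; rewrite ?cat0s ?cat_cons.
  move=> _ [sy] sy' ry ry'.
  have first_letter z : size z = M ->
      sub s (s :: z) (s :: sub s.+1 (map (bump s) w1) w2) =
      s :: sub s.+1 (sub s.+1 z (map (bump s) w1)) w2.
    move=> sz; rewrite -sub_comp ?size_map ?sw1; last exact: rigid_lt rw2.
    by rewrite sub_level; congr cons; apply: eq_map => d; exact: ext_cons_level.
  rewrite !first_letter ?sy' //.
  by apply: hw2; rewrite ?size_sub ?size_map //; apply: rigid_sub => //;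
    rewrite ?sy' sy.
move=> /andP[cs xs]; rewrite addSn => -[sxy] sy' ry ry'.
rewrite !sub_level !sub_cons_comp ?sw1; try exact: rigid_lt rw2.
have /ffunP /(_ (Ordinal cs)) := hw1 x y y' xs sxy sy' ry ry'.
by rewrite !ffunE.
Qed.

(** A word whose new parameters are introduced exactly at the marked positions,
the other positions being filled with the constant 0.  After a substitution, the
first parameter can therefore occur at a marked position only. *)
Fixpoint spread s (b : seq bool) :=
  if b is c :: b' then
    if c then s :: spread s.+1 b' else 0 :: spread s b'
  else [::].

Lemma size_spread s b : size (spread s b) = size b.
Proof. by elim: b s => [|[] b IH] s //=; rewrite IH. Qed.

Lemma rigid_spread s b : 0 < s -> rigid s (s + count id b) (spread s b).
Proof.
elim: b s => [|[] b IH] s s0 /=; first by rewrite addn0.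
  by rewrite ltnn eqxx /= add1n -addSnnS IH.
by rewrite s0 add0n IH.
Qed.

Lemma nth_spread s b p : ~~ nth false b p -> nth 0 (spread s b) p = 0.
Proof.
elim: b s p => [|[] b IH] s [|p] //=; exact: IH.
Qed.

Lemma thin_mask m b : m <= count id b ->
  exists b', [/\ size b' = size b, count id b' = m &
    forall p, nth false b' p -> nth false b p].
Proof.
elim: b m => [|c b IH] m /=; first by rewrite leqn0 => /eqP ->; exists [::].
case: c m => [[|m]|m] /=.
- move=> _; have [b' [sb' cb' hb']] := IH 0 isT.
  by exists (false :: b'); split=> [||[|p]] //=; [rewrite sb'|exact: hb'].
- rewrite add1n ltnS => /IH[b' [sb' cb' hb']].
  exists (true :: b'); split=> [||[|p]] //=; [by rewrite sb'|by rewrite cb'|].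
  exact: hb'.
- rewrite add0n => /IH[b' [sb' cb' hb']].
  by exists (false :: b'); split=> [||[|p]] //=; [rewrite sb'|exact: hb'].
Qed.

Lemma popular_color m (K : finType) (kappa : nat -> K) :
  exists k0, m <= count (fun i => kappa i == k0) (iota 0 (m * #|K|)).
Proof.
apply/existsP; apply: contraT; rewrite negb_exists => /forallP few.
have total n : \sum_(k : K) count (fun i => kappa i == k) (iota 0 n) = n.
  rewrite -[RHS](size_iota 0).
  under eq_bigr do rewrite -sum1_count big_mkcond.
  rewrite exchange_big /= -sum1_size; apply: eq_bigr => i _.
  by rewrite -big_mkcond /= (big_pred1 (kappa i)) // => k; rewrite /= eq_sym.
have : \sum_(k : K) (count (fun i => kappa i == k) (iota 0 (m * #|K|)) + 1)
       <= \sum_(k : K) m.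
  by apply: leq_sum => k _; rewrite addn1 ltnNge few.
rewrite big_split /= total sum1_card sum_nat_const [X in _ <= X]mulnC.
have : 0 < #|K| by apply/card_gt0P; exists (kappa 0).
have -> : #|(xpredT : pred K)| = #|K| by exact: eq_card.
by move=> K0; rewrite -[X in _ <= X]addn0 leq_add2l leqNgt K0.
Qed.

Lemma map_const_seq (x : seq nat) : map (fun=> 0) x = nseq (size x) 0.
Proof. by elim: x => //= _ x ->. Qed.

(** The word is composed of three: [w1] makes the color depend on the prefix before
the first parameter only, [w2] makes it depend on the number of
parameters of [w2] that this prefix involves, and [w3] only allows numbers of the
most popular color. *)
Lemma graham_rothschild_step s u :
  s.+1 < u -> graham_rothschild s.+2 u -> graham_rothschild s.+1 u.
Proof.
move=> su gr m K.
have [//|M hM] := @block_lines s.+1 (fun=> 0) (m * #|K|) K _ (@hales_jewett s).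
have [N hN] := prefix_reduction M K gr.
exists N => chi.
have [w1 [sw1 rw1 hw1]] := hN chi.
(* A padded list of the remaining parameters, which together with [s.+1]
   completes a prefix of length [i] to a rigid word of length [M]. *)
pose y0 i := iota s.+2 (u - s.+2) ++ nseq (M - i.+1 - (u - s.+2)) 0.
pose chi2 x := chi (sub s.+1 (x ++ s.+1 :: y0 (size x)) w1).
have [w2 [sw2 rw2 hw2]] := hM chi2.
pose kappa i := chi2 (pre s.+1 (nseq i 0) w2).
have [k0 pop] := popular_color m kappa.
have [|b [sb cb hb]] :=
  @thin_mask m [seq kappa i == k0 | i <- iota 0 (m * #|K|)].
  by rewrite count_map.
pose w3 := spread s.+1 b.
have sw3 : size w3 = m * #|K| by rewrite size_spread sb size_map size_iota.
have rw3 : rigid s.+1 (s.+1 + m) w3 by rewrite -cb; exact: rigid_spread.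
have all_k0 f : size f = m -> rigid s.+1 u f ->
    chi (sub s.+1 f (sub s.+1 (sub s.+1 w3 w2) w1)) = k0.
  move=> sf rf.
  have w2lt := rigid_lt rw2; have w1lt := rigid_lt rw1.
  rewrite sub_comp ?size_sub ?sw2 // sub_comp ?sw3 //.
  have : rigid s.+1 u (sub s.+1 f w3) by apply: rigid_sub; rewrite ?sf.
  have := size_sub s.+1 f w3; move eh : (sub s.+1 f w3) => h sh rh.
  have [|x [y [exy xs]]] := rigid_split (j := s.+1) rh; first by rewrite leqnn.
  have bx : nth false b (size x).
    apply: contraT => /(nth_spread s.+1) w3x.
    have : nth 0 h (size x) = s.+1 by rewrite exy nth_cat ltnn subnn.
    rewrite -eh (nth_map 0) ?w3x //.
    by rewrite -sh exy size_cat /=; lia.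
  have kx : kappa (size x) = k0.
    have xm : size x < m * #|K| by rewrite -sw3 -sh exy size_cat /=; lia.
    have := hb _ bx; rewrite (nth_map 0) ?size_iota // nth_iota //.
    by move/eqP.
  rewrite exy in rh sh *.
  have [|y2 [ey2 ps ry2]] := sub_pre (w := w2) xs rh; first by rewrite sh sw3.
  have := size_sub s.+1 (x ++ s.+1 :: y) w2.
  rewrite ey2 size_cat sw2 /= => sp; have uy2 := rigid_size ry2.
  set p := pre s.+1 x w2 in ps sp *.
  transitivity (chi2 p).
    apply: hw1 => //.
      by rewrite /y0 size_cat size_iota size_nseq; lia.
    apply: rigid_cat (rigid_iota _ _) _; rewrite subnKC; last by lia.
    by apply: rigid_const; rewrite all_nseq orbC /= (ltn_trans _ su).
  rewrite -kx /kappa /p hw2 //; first by rewrite map_const_seq.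
  by rewrite -sw3 -sh size_cat leq_addr.
exists (sub s.+1 (sub s.+1 w3 w2) w1); split.
- by rewrite size_sub.
- apply: rigid_sub; rewrite ?size_sub ?sw2 //.
  by apply: rigid_sub; rewrite ?sw3.
by move=> f g sf sg rf rg; rewrite !all_k0.
Qed.

(** There is a constant because the pigeonhole argument fills the unmarked
positions with 0. *)
Theorem graham_rothschild_rigid s d : graham_rothschild s.+1 (s.+1 + d).
Proof.
elim: d s => [|d IH] s.
  rewrite addn0 => m K.
  have [//|N hN] := @block_lines s.+1 (fun=> 0) m K _ (@hales_jewett s).
  exists N => chi; have [w [sw rw hw]] := hN chi; exists w; split=> //.
  move=> f g sf sg /rigid_lt fs /rigid_lt gs; have wl := rigid_lt rw.
  rewrite -!pre_full ?sf ?sg // hw ?sf // [RHS]hw ?sg //.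
  by rewrite !map_const_seq sf sg.
by apply: graham_rothschild_step; [lia | rewrite -addSnnS; exact: IH].
Qed.

(** * The dual Ramsey theorem for finite sets *)

(** Every word is a rigid word up to the names of its letters: [u] lists the
letters of [g] in the order of their first occurrences. *)
Lemma first_occurrences (T : eqType) (x0 : T) (g : seq T) : exists u f,
  [/\ uniq u, u =i g, rigid 0 (size u) f & g = map (nth x0 u) f].
Proof.
elim/last_ind: g => [|g x [u [f [uu ug rf eg]]]]; first by exists [::], [::].
have fu := allP (rigid_lt rf).
have [xu|xu] := boolP (x \in u).
  exists u, (rcons f (index x u)); split=> //.
  - move=> y; rewrite mem_rcons inE -ug; case: eqP => // ->.
    by rewrite xu.
  - by rewrite -cats1; apply: rigid_cat rf _; rewrite /= index_mem xu.
  - by rewrite map_rcons nth_index // -eg.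
exists (rcons u x), (rcons f (size u)); split.
- by rewrite rcons_uniq xu.
- by move=> y; rewrite !mem_rcons !inE ug.
- rewrite size_rcons -cats1; apply: rigid_cat rf _.
  by rewrite /= ltnn !eqxx.
rewrite map_rcons nth_rcons ltnn eqxx {1}eg; congr rcons.
by apply/eq_in_map => c /fu /= cu; rewrite nth_rcons cu.
Qed.

(** A nonempty rigid word without constants begins with the letter 0, which can
serve as a constant in the rest of the word.  For each arrangement [u] of the
target, the coloring of rigid words relabeled by [u] is made constant, all arrangements being treated together; the color of a
composite [g . w] then depends only on the order [u] in which [g] takes its
values.  Hence the bound by the number of lists [u]. *)
Theorem dual_ramsey a b (K : finType) : exists N, forall chi : seq 'I_a.+1 -> K,
  exists w : N.+1.-tuple 'I_b.+1, (forall y, y \in w) /\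
  exists kappa : a.+1.-tuple 'I_a.+1 -> K,
  forall g : 'I_b.+1 -> 'I_a.+1, (forall y, exists x, g x = y) ->
  exists u, chi (map g w) = kappa u.
Proof.
have [N hN] :=
  @graham_rothschild_rigid 0 a b {ffun a.+1.-tuple 'I_a.+1 -> K}.
exists N => chi.
have [w [sw rw hw]] := hN (fun z => [ffun u : a.+1.-tuple 'I_a.+1 =>
  chi (map (nth ord0 u) (0 :: z))]).
have wlt := allP (rigid_lt rw).
have sw' : size (map (@inord b) (0 :: w)) == N.+1 by rewrite size_map /= sw.
exists (Tuple sw'); split=> [y|].
  apply/mapP; exists (nat_of_ord y); last by rewrite inord_val.
  case: (posnP y) => [->|y0]; first by rewrite mem_head.
  rewrite inE; apply/orP; right.
  have [|w0 [w' [-> _]]] := rigid_split (j := y) rw.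
    by rewrite y0 add1n ltn_ord.
  by rewrite mem_cat mem_head orbT.
(* Any rigid word of the right size serves as a reference for the common
   color; this one exists whenever [g] does. *)
pose f0 := iota 1 a ++ nseq (b - a) 0.
exists (fun u => chi (map (nth ord0 u) (0 :: sub 1 f0 w))) => g gsurj.
have [u [f [uu ug rf eg]]] := first_occurrences ord0 (map g (enum 'I_b.+1)).
have su : size u = a.+1.
  rewrite -[RHS]card_ord -(card_uniqP uu); apply: eq_card => y; rewrite ug.
  have [x <-] := gsurj y.
  by rewrite map_f // mem_enum.
have sf : size f = b.+1.
  by rewrite -(size_map (nth ord0 u)) -eg size_map size_enum_ord.
have gE (c : 'I_b.+1) : g c = nth ord0 u (nth 0 f c).
  rewrite -(nth_map 0 ord0 (nth ord0 u)) ?sf // -eg.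
  by rewrite (nth_map ord0) ?size_enum_ord // nth_ord_enum.
case: f rf sf eg gE => [|c f] //=; rewrite su.
case: c => // rf [sf] _ gE.
have su' : size u == a.+1 by rewrite su.
exists (Tuple su').
transitivity (chi (map (nth ord0 u) (0 :: sub 1 f w))).
  congr chi; rewrite /= gE inordK //=; congr cons.
  rewrite /sub -!map_comp; apply/eq_in_map => c /wlt /= cb.
  rewrite gE inordK //.
  by case: c cb => [|c] _ //=; rewrite /ext subn1.
have ab := rigid_size rf.
have [sf0 rf0] : size f0 = b /\ rigid 1 a.+1 f0.
  rewrite size_cat size_iota size_nseq; split; first by lia.
  apply: rigid_cat (rigid_iota _ _) _; rewrite add1n.
  by apply: rigid_const; rewrite all_nseq orbT.
rewrite add1n in hw.
by have /ffunP /(_ (Tuple su')) := hw f f0 sf sf0 rf rf0; rewrite !ffunE.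
Qed.

(** * Algebras of term functions *)

Lemma finite_enum T : inhabited T -> finite_set [set: T] ->
  exists n (e : 'I_n.+1 -> T) (d : T -> 'I_n.+1), cancel e d /\ cancel d e.
Proof.
move=> [x0] /(@finite_seqP {classic T})[s es].
pose u := undup (s : seq {classic T}).
have inu (x : {classic T}) : x \in u.
  by rewrite mem_undup; have : [set: {classic T}]%classic x by []; rewrite es.
have u0 : size u = (size u).-1.+1.
  by rewrite prednK //; case: (u) (inu x0).
exists (size u).-1, (fun i => nth (x0 : {classic T}) u i),
  (fun x => inord (index (x : {classic T}) u)); split=> [i|x].
  have iu : i < size u by apply: leq_trans (ltn_ord i) _; rewrite -u0.
  by rewrite index_uniq ?undup_uniq ?inord_val.
by rewrite inordK ?nth_index // -u0 index_mem.
Qed.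

Lemma finite_set_injective (T : Type) (F : finType) (h : T -> F) :
  injective h -> finite_set [set: T].
Proof.
move=> hi; apply: (@finite_preimage _ _ [set: F]%classic h) => // x y _ _.
exact: hi.
Qed.

Section TermAlgebra.
Variable Omega : language.

(** The arguments of a symbol are nested in a finite function, so the induction
hypothesis for them has to be supplied by an explicit fixpoint. *)
Lemma term_induction (P : term Omega -> Prop) :
  (forall n, P (Var Omega n)) ->
  (forall (f : Omega) (ts : {ffun 'I_(arity f) -> term Omega}),
    (forall i, P (ts i)) -> P (App ts)) ->
  forall t, P t.
Proof.
move=> PVar PApp; fix IH 1 => -[n|f ts]; first exact: PVar.
by apply: PApp => i; apply: IH.
Qed.

Lemma hom_eval (A B : algebra Omega) (h : A -> B) v t : homomorphism h ->
  h (eval v t) = eval (h \o v) t.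
Proof.
move=> hh; elim/term_induction: t => [//|f ts IH] /=.
by rewrite hh; congr op; apply/ffunP => i; rewrite !ffunE IH.
Qed.

Variables (N : nat) (B : algebra Omega).

(** Reading the variable [n] as [minn n N] leaves the [N.+1] variables
[0], ..., [N], so that term functions depend on finitely many values of [v]. *)
Definition assignment (v : nat -> B) (n : nat) : B := v (minn n N).

Definition term_function :=
  {h : (nat -> B) -> B | exists t, forall v, h v = eval (assignment v) t}.

Lemma term_function_inj (h g : term_function) : sval h =1 sval g -> h = g.
Proof.
case: h g => [h hP] [g gP] /= /funext e; move: hP gP; rewrite e => hP gP.
by rewrite (Prop_irrelevance hP gP).
Qed.

Lemma term_function_op_subproof (f : Omega)
    (hs : {ffun 'I_(arity f) -> term_function}) :
  exists t, forall v,
    op [ffun i => sval (hs i) v] = eval (assignment v) t.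
Proof.
have /choice[ts tsP] : forall i, exists t, forall v,
    sval (hs i) v = eval (assignment v) t by move=> i; exact: svalP (hs i).
exists (App (finfun ts)) => v /=; congr op.
by apply/ffunP => i; rewrite !ffunE tsP.
Qed.

Definition term_function_op (f : Omega) hs : term_function :=
  exist _ _ (@term_function_op_subproof f hs).

Lemma term_function_of_term (t : term Omega) :
  exists t', forall v, eval (assignment v) t = eval (assignment v) t'.
Proof. by exists t. Qed.

Lemma term_function_inhabited : inhabited term_function.
Proof. exact: (inhabits (exist _ _ (term_function_of_term (Var Omega 0)))). Qed.

Definition term_algebra : algebra Omega :=
  Algebra term_function_inhabited term_function_op.

Definition generator (n : nat) : term_algebra :=
  exist _ _ (term_function_of_term (Var Omega n)).

Definition evaluation (v : nat -> B) (h : term_algebra) : B := sval h v.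

Lemma evaluation_hom v : homomorphism (evaluation v).
Proof. by move=> f hs. Qed.

(** The evaluations are homomorphisms to [B] that jointly separate points, so
identities of [B] are inherited. *)
Lemma term_algebra_satisfies e : satisfies B e -> satisfies term_algebra e.
Proof.
move=> Be rho; apply: term_function_inj => v.
have := Be (evaluation v \o rho).
by rewrite -!(hom_eval _ _ (@evaluation_hom v)).
Qed.

Lemma term_algebra_generated (h : term_algebra) :
  exists t, h = eval generator t.
Proof.
have [t ht] := svalP h; exists t; apply: term_function_inj => v.
by rewrite ht -[RHS]/(evaluation v _) (hom_eval _ _ (@evaluation_hom v)).
Qed.

Lemma generator_minn n : generator n = generator (minn n N).
Proof.
by apply: term_function_inj => v; rewrite /= /assignment -minnA minnn.
Qed.

Lemma hom_eq_generators (A : algebra Omega) (h g : term_algebra -> A) :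
  homomorphism h -> homomorphism g ->
  (forall n, n <= N -> h (generator n) = g (generator n)) -> h =1 g.
Proof.
move=> hh hg e x; have [t ->] := term_algebra_generated x.
rewrite !hom_eval //; congr eval; apply: funext => n /=.
by rewrite generator_minn e // geq_minr.
Qed.

(** A term function is determined by its values at the finitely many assignments
to the variables [0], ..., [N]. *)
Lemma term_algebra_finite :
  finite_set [set: B] -> finite_set [set: term_algebra].
Proof.
move=> /(finite_enum (carrier_nonempty B))[n [e [d [_ de]]]].
pose code (h : term_algebra) := [ffun v : {ffun 'I_N.+1 -> 'I_n.+1} =>
  d (sval h (fun i => e (v (inord i))))].
apply: (@finite_set_injective _ _ code) => h g /ffunP hg.
apply: term_function_inj => v; apply: (can_inj de).
have := hg [ffun i => d (v (val i))]; rewrite !ffunE.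
have restrict (f : term_algebra) : sval f v =
    sval f (fun i => e ([ffun i : 'I_N.+1 => d (v (val i))] (inord i))).
  have [t ft] := svalP f; rewrite !ft; congr eval; apply: funext => i.
  by rewrite /assignment ffunE de /= inordK // ltnS geq_minr.
by rewrite -!restrict.
Qed.

End TermAlgebra.

Lemma evaluation_surj Omega N (B : algebra Omega) (v : nat -> B) :
  (forall y, exists2 n, n <= N & v n = y) ->
  forall y, exists h : term_algebra N B, evaluation v h = y.
Proof.
move=> vs y; have [n nN <-] := vs y.
by exists (generator N B n); rewrite /evaluation /= /assignment (minn_idPl nN).
Qed.

(** * Dual small Ramsey degrees *)

Lemma finite_degree_of_bound (C : category) (A : C) n :
  dual_ramsey_bound A n -> exists m, dual_small_ramsey_degree A = Some m.
Proof.
move=> bd; rewrite /dual_small_ramsey_degree; case: pselect => [ex|[]].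
  by exists (ex_minn ex).
by exists n; apply/asboolP.
Qed.

Theorem corollary4p14 (Omega : language) (V : set (algebra Omega)) :
  variety V -> nontrivial V ->
  finite_dual_small_ramsey_degrees (fin_epi_category V).
Proof.
move=> [E eV] _ A.
have [a [eA [dA [eAK dAK]]]] :=
  finite_enum (carrier_nonempty A) (fin_alg_finite A).
apply: (@finite_degree_of_bound _ _ #|{: a.+1.-tuple 'I_a.+1}|); split.
  by apply/card_gt0P; exists [tuple ord0 | i < a.+1].
move=> k k2 B.
have [b [eB [dB [eBK dBK]]]] :=
  finite_enum (carrier_nonempty B) (fin_alg_finite B).
have [N hN] := dual_ramsey a b 'I_k.
have VX (D : algebra Omega) : V D -> V (term_algebra N D).
  by rewrite eV => VD e Ee; exact/term_algebra_satisfies/VD.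
pose X := FinAlgebraIn (VX _ (fin_alg_in B))
  (term_algebra_finite N (fin_alg_finite B)).
exists X => chi.
have k0 : 0 < k by exact: ltnW.
pose gens (h : epi X A) := [seq dA (h (generator N B i)) | i : 'I_N.+1].
(* The coloring of epimorphisms, transported to lists of values on the
   generators; lists that come from no epimorphism get a default color. *)
pose col l := if pselect (exists h, gens h = l) is left ex
  then chi (projT1 (cid ex)) else Ordinal k0.
have colE h : col (gens h) = chi h.
  rewrite /col; case: pselect => [ex|[]]; last by exists h.
  case: cid => g /= eg; congr chi; apply: epi_ext.
  apply/funext/hom_eq_generators; try exact: epi_hom.
  move=> n nN; apply: (can_inj dAK).
  by have /eq_in_map /(_ (Ordinal (nN : n < N.+1)) (mem_enum _ _)) := eg.
have [w [wsurj [kappa hw]]] := hN col.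
pose v i := eB (nth ord0 w i).
have vsurj y : exists2 n, n <= N & v n = y.
  have /(nthP ord0)[i iN ei] := wsurj (dB y); exists i.
    by rewrite size_tuple in iN.
  by rewrite /v ei dBK.
pose ev : epi X B := Epi (@evaluation_hom _ N B v) (evaluation_surj vsurj).
exists ev.
apply: leq_trans (_ : #|[set kappa u | u in {: a.+1.-tuple 'I_a.+1}]%SET| <= _);
  last exact: leq_imset_card.
apply: subset_leq_card; apply/fintype.subsetP => c.
rewrite inE => /asboolP[f <-].
have [y|u hu] := hw (fun j => dA (f (eB j))).
  have [x ex] := epi_surj f (eA y).
  by exists (dB x); rewrite dBK ex eAK.
suff -> : chi (epi_comp f ev) = kappa u by apply: imset_f.
rewrite -colE -hu; congr col.
rewrite -[in RHS](map_tnth_enum w) -map_comp; apply: eq_map => i /=.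
rewrite /evaluation /= /assignment (minn_idPl (ltn_ord i : i <= N)).
by rewrite /v -tnth_nth.
Qed.
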